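(* Let $X$ be a metric space with completion $\widetilde{X}$, let $L\geq 0$, let $\mathcal{J}\subset PCl(X)$ be a stable covering subspace, and let $A,B\in\mathcal{J}$. There exists an $L$-Lipschitz path $\gamma:[0,1]\to\mathcal{J}$ from $A$ to $B$ if and only if there exists a family $\{\gamma_r:[0,1]\to\widetilde{X}\}_{r\in\Gamma}$ of $L$-Lipschitz paths in $\widetilde{X}$, where $\gamma_r$ is a path from $\gamma_r(0)\in\widetilde{A}$ to $\gamma_r(1)\in\widetilde{B}$, such that (i) $R:=\{(\gamma_r(0),\gamma_r(1)):r\in\Gamma\}\subset\widetilde{A}\times\widetilde{B}$ is a densely complete relation, and (ii) $cl_{\widetilde{X}}\{\gamma_r(t):r\in\Gamma\}\cap X\in\mathcal{J}$ for all $t\in[0,1]$. Moreover: (a) Given an $L$-Lipschitz path $\gamma:[0,1]\to\mathcal{J}$ from $A$ to $B$, the family of paths can be chosen such that (iii) $\gamma(t)=cl_{\widetilde{X}}\{\gamma_r(t):r\in\Gamma\}\cap X$ for all $t\in[0,1]$. (b) When $\mathcal{J}\subset K(X)$, one can replace $\widetilde{X}$ with $X$ throughout (so the $\gamma_r$ are $L$-Lipschitz paths in $X$ from points of $A$ to points of $B$, $R\subset A\times B$ is densely complete, and the representation (iii) reads $\gamma(t)=cl_X\{\gamma_r(t):r\in\Gamma\}$ for all $t\in[0,1]$), and the collection $\{\gamma_r:[0,1]\to X\}_{r\in\Gamma}$ in the representation (iii) can be chosen to be maximal. In particular, the equivalence between the existence of an $L$-Lipschitz path $\gamma:[0,1]\to\mathcal{J}$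 from $A$ to $B$ and the existence of a family $\{\gamma_r\}_{r\in\Gamma}$ of $L$-Lipschitz paths satisfying (i) and (ii), together with conclusions (a) and (b), applies to a $\lambda$-quasigeodesic $\gamma$ from $A$ to $B$ (for $\lambda\geq 1$) with $L:=\lambda d_H(A,B)$, and to a rectifiable path $\gamma$ from $A$ to $B$ (parametrized with constant speed) with $L:=\ell(\gamma)$.
   Context: For a metric space $X$, $\widetilde{X}$ denotes its completion (with $X\subset\widetilde X$ dense), $cl_Y$ denotes closure in $Y$, and for $A\subset X$, $\widetilde{A}:=cl_{\widetilde{X}}(A)$. The Hausdorff distance is $d_H(A,B)=\max\{\sup_{a\in A}\inf_{b\in B}d(a,b),\ \sup_{b\in B}\inf_{a\in A}d(a,b)\}$. $BCl(X)$ is the metric space (with $d_H$) of nonempty bounded closed subsets of $X$; $PCl(X)\subset BCl(X)$ consists of the totally bounded members; $K(X)\subset PCl(X)$ consists of the compact members. A subspace $\mathcal{J}\subset BCl(X)$ is a stable covering subspace if $\{x\}\in\mathcal{J}$ for all $x\in X$ (covering) and $BCl(C)\subset\mathcal{J}$ for all $C\in\mathcal{J}$ (stable). A path in a space $Y$ from $y$ to $y'$ is a continuous map $\gamma:[0,1]\to Y$ with $\gamma(0)=y$, $\gamma(1)=y'$. A map $f$ between metric spaces is $L$-Lipschitz if $d(f(u),f(v))\leq L\,d(u,v)$ for all $u,v$. The length $\ell(\gamma)$ is the supremum of $\sum_i d(\gamma(t_{i-1}),\gamma(t_i))$ over finite partitions of $[0,1]$; $\gamma$ is rectifiable if $\ell(\gamma)<\infty$,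 and it has constant speed if $\ell(\gamma|_{[t,t']})=\ell(\gamma)|t-t'|$ for all $t\le t'$. A path $\gamma$ is a $\lambda$-quasigeodesic if $d(\gamma(t),\gamma(t'))\leq\lambda d(\gamma(0),\gamma(1))|t-t'|$ for all $t,t'\in[0,1]$. A relation $R\subset A\times B$ between subsets $A,B$ of a space is densely complete if its domain $\{a\in A:(\{a\}\times B)\cap R\neq\emptyset\}$ is dense in $A$ and its image $\{b\in B:(A\times\{b\})\cap R\neq\emptyset\}$ is dense in $B$. A collection of paths is maximal if it is not properly contained in a larger collection of $L$-Lipschitz paths in $X$ from points of $A$ to points of $B$ with the same properties (densely complete endpoint relation and the representation of $\gamma$).
   Formalization: For families in the completion, (ii) also requires each closed slice cl{γ_r(t)} to be the closure of its intersection with X; without this the ''if'' direction fails (X=ℚ, L=1, A={0,5}, B={1,5}, paths t and 5). It is automatic when X is complete. *)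

(* Defs.v *)
From HB Require Import structures.
From mathcomp Require Import all_boot all_order all_algebra.
From mathcomp Require Import all_classical all_reals all_analysis.

Set Implicit Arguments.
Unset Strict Implicit.
Unset Printing Implicit Defensive.

Import Order.TTheory GRing.Theory Num.Theory numFieldNormedType.Exports.

Local Open Scope classical_set_scope.
Local Open Scope ring_scope.

Section MetricSpaces.
Context {R : realType}.

Definition metric_bounded {X : metricType R} (A : set X) : Prop :=
  exists M : R, forall x y, A x -> A y -> mdist x y <= M.

Definition totally_bounded {X : metricType R} (A : set X) : Prop :=
  forall e : R, 0 < e -> exists F : set X,
    [/\ finite_set F, F `<=` A & A `<=` \bigcup_(x in F) ball x e].

(* [completeType] is not used because it forces the space to be pointed. *)
Definition complete_space (X : metricType R) : Prop :=
  forall F : set_system X, ProperFilter F -> cauchy F -> exists l : X, F --> l.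

Definition is_completion {X Xt : metricType R} (iota : X -> Xt) : Prop :=
  [/\ forall x y, mdist (iota x) (iota y) = mdist x y,
      dense (range iota) & complete_space Xt].

(* The nonempty bounded closed subsets of the subspace C of X; the topology of
   [subspace C] is the one in which the subsets of C closed in C are closed. *)
Definition BCl_in {X : metricType R} (C : set X) : set (set X) :=
  [set D | [/\ D `<=` C, D !=set0, metric_bounded D
             & closed (D : set (subspace C))]].

End MetricSpaces.

Record bcl (R : realType) (X : metricType R) := Bcl {
  bcl_set :> set X;
  bcl_neq0 : bcl_set !=set0;
  bcl_bounded : metric_bounded bcl_set;
  bcl_closed : closed bcl_set }.

Arguments bcl_closed {R X} b.

Section HausdorffDistance.
Context {R : realType} {X : metricType R}.
Implicit Types A B C : set X.

Definition excess A B : R :=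
  sup [set inf [set mdist a b | b in B] | a in A].

Definition hausdorff_dist A B : R := Num.max (excess A B) (excess B A).

Lemma bcl_eq (A B : bcl X) : bcl_set A = bcl_set B -> A = B.
Proof.
case: A B => [A A0 Ab Ac] [B B0 Bb Bc] /= AB; rewrite -AB in B0 Bb Bc *.
by rewrite (Prop_irrelevance A0 B0) (Prop_irrelevance Ab Bb)
           (Prop_irrelevance Ac Bc).
Qed.

Lemma excess_leP (A B : bcl X) (e : R) : excess A B <= e <->
  forall a d, bcl_set A a -> 0 < d -> exists2 b, bcl_set B b & mdist a b < e + d.
Proof.
have infB a : has_inf [set mdist a b | b in B].
  split; first by case: (bcl_neq0 B) => b Bb; exists (mdist a b), b.
  by exists 0 => _ [b _ <-]; exact: mdist_ge0.
have ubA : has_ubound [set inf [set mdist a b | b in B] | a in A].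
  have [a0 Aa0] := bcl_neq0 A; have [b0 Bb0] := bcl_neq0 B.
  have [M AM] := bcl_bounded A; exists (M + mdist a0 b0) => _ [a Aa <-].
  apply: (@le_trans _ _ (mdist a b0)).
    by apply: (ge_inf (infB a).2); exists b0.
  by apply: le_trans (metric_triangle _ a0 _) _; rewrite lerD2r; exact: AM.
split=> [le_e a d Aa d0|H].
  have [_ [b Bb <-] lt_b] := @inf_adherent _ _ d d0 (infB a).
  exists b => //; apply: lt_le_trans lt_b _; rewrite lerD2r.
  by apply: le_trans le_e; apply: ub_le_sup => //; exists a.
apply: ge_sup => [|_ [a Aa <-]].
  by case: (bcl_neq0 A) => a Aa; exists (inf [set mdist a b | b in B]), a.
apply/ler_addgt0Pr => d d0; have [b Bb /ltW] := H a d Aa d0.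
by apply: le_trans; apply: (ge_inf (infB a).2); exists b.
Qed.

Lemma excess_ge0 (A B : bcl X) : 0 <= excess A B.
Proof.
apply/ler_addgt0Pr => d d0; have [a Aa] := bcl_neq0 A.
have [b _] := (excess_leP A B _).1 (lexx _) a d Aa d0.
by move/ltW; apply: le_trans; exact: mdist_ge0.
Qed.

Lemma excess_le0 (A B : bcl X) : excess A B <= 0 -> bcl_set A `<=` bcl_set B.
Proof.
move=> /excess_leP AB a Aa; have /closure_id -> := bcl_closed B.
move=> U /nbhs_ballP[e /= e0 aeU]; have [b Bb] := AB a e Aa e0.
rewrite add0r => abe; exists b; split => //.
by apply: aeU; rewrite ballEmdist.
Qed.

Definition bcl_dist (A B : bcl X) : R := hausdorff_dist A B.

Lemma bcl_distxx (A : bcl X) : bcl_dist A A = 0.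
Proof.
rewrite /bcl_dist /hausdorff_dist maxxx; apply/eqP; rewrite eq_le excess_ge0 andbT.
by apply/excess_leP => a d Aa d0; exists a; rewrite // mdistxx add0r.
Qed.

Lemma bcl_dist_positivity (A B : bcl X) : bcl_dist A B = 0 -> A = B.
Proof.
move=> AB0; have : bcl_dist A B <= 0 by rewrite AB0.
rewrite ge_max => /andP[/excess_le0 AB /excess_le0 BA].
by apply: bcl_eq; apply/seteqP; split.
Qed.

Lemma bcl_dist_sym (A B : bcl X) : bcl_dist A B = bcl_dist B A.
Proof. by rewrite /bcl_dist /hausdorff_dist maxC. Qed.

Lemma excess_triangle (B A C : bcl X) : excess A C <= excess A B + excess B C.
Proof.
apply/excess_leP => a d Aa d0; have d20 : 0 < d / 2 by rewrite divr_gt0.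
have [b Bb ab] := (excess_leP A B _).1 (lexx _) a _ Aa d20.
have [c Cc bc] := (excess_leP B C _).1 (lexx _) b _ Bb d20.
exists c => //; apply: le_lt_trans (metric_triangle a b c) _.
by rewrite [d in _ < _ + d]splitr addrACA ltrD.
Qed.

Lemma bcl_dist_triangle (B A C : bcl X) :
  bcl_dist A C <= bcl_dist A B + bcl_dist B C.
Proof.
rewrite ge_max; apply/andP; split.
  apply: le_trans (excess_triangle B A C) _.
  by apply: lerD; rewrite le_max lexx.
apply: le_trans (excess_triangle B C A) _; rewrite addrC.
by apply: lerD; rewrite le_max lexx orbT.
Qed.

HB.instance Definition _ := gen_eqMixin (bcl X).
HB.instance Definition _ := gen_choiceMixin (bcl X).
HB.instance Definition _ := @isMetric.Build R (bcl X)
  bcl_dist bcl_distxx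
  bcl_dist_positivity bcl_dist_sym bcl_dist_triangle.

End HausdorffDistance.

Section Subspaces.
Context {R : realType} (X : metricType R).

Definition PCl : set (bcl X) := [set C | totally_bounded C].

Definition KCl : set (bcl X) := [set C | compact C].

(* [mem_sub J S]: the set S, which is not a priori closed, bounded or nonempty,
   is a member of J. *)
Definition mem_sub (J : set (bcl X)) (S : set X) : Prop :=
  exists2 C : bcl X, J C & bcl_set C = S.

Definition covering (J : set (bcl X)) : Prop :=
  forall x : X, mem_sub J [set x].

Definition stable (J : set (bcl X)) : Prop :=
  forall C : bcl X, J C -> BCl_in C `<=` mem_sub J.

End Subspaces.

Notation unit_itv R := (set_type `[0 : R, 1]%classic).

Section Paths.
Context {R : realType}.

Lemma unit_itv0_subproof : (0 : R) \in `[0 : R, 1]%classic.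
Proof. by rewrite inE /= in_itv /= lexx ler01. Qed.

Lemma unit_itv1_subproof : (1 : R) \in `[0 : R, 1]%classic.
Proof. by rewrite inE /= in_itv /= lexx ler01. Qed.

Definition i0 : unit_itv R := exist _ 0 unit_itv0_subproof.

Definition i1 : unit_itv R := exist _ 1 unit_itv1_subproof.

Definition is_path {T : topologicalType} (x y : T) (g : unit_itv R -> T) : Prop :=
  [/\ continuous g, g i0 = x & g i1 = y].

Context {T : metricType R}.
Implicit Types (g : unit_itv R -> T) (s t : unit_itv R).

Definition lipschitz_map (L : R) g : Prop :=
  forall s t, mdist (g s) (g t) <= L * `|\val s - \val t|.

Definition lipschitz_path (L : R) (x y : T) g : Prop :=
  is_path x y g /\ lipschitz_map L g.

Definition quasigeodesic (lambda : R) (x y : T) g : Prop :=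
  is_path x y g /\ forall s t,
    mdist (g s) (g t) <= lambda * mdist (g i0) (g i1) * `|\val s - \val t|.

(* The length of the restriction of g to [s, t]; the list p enumerates the
   points of a partition other than s. *)
Definition path_length g s t : \bar R :=
  ereal_sup [set (\sum_(k < size p) mdist (g (nth s (s :: p) k)) (g (nth s p k)))%:E
            | p in [set p : seq (unit_itv R) |
                    itv_partition (\val s) (\val t) [seq \val u | u <- p]]].

Definition rectifiable g : Prop := (path_length g i0 i1 < +oo)%E.

Definition constant_speed g : Prop :=
  forall s t, \val s <= \val t ->
    path_length g s t = (path_length g i0 i1 * `|\val s - \val t|%:E)%E.

Definition rel_dom (A B : set T) (Q : set (T * T)) : set T :=
  [set a | A a /\ ([set a] `*` B) `&` Q !=set0].

Definition rel_img (A B : set T) (Q : set (T * T)) : set T :=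
  [set b | B b /\ (A `*` [set b]) `&` Q !=set0].

Definition densely_complete (A B : set T) (Q : set (T * T)) : Prop :=
  [/\ Q `<=` A `*` B,
      A `<=` closure (rel_dom A B Q) & B `<=` closure (rel_img A B Q)].

Section Family.
Context {G : Type} (g : G -> unit_itv R -> T).

Definition endpoints : set (T * T) := [set (g r i0, g r i1) | r in setT].

Definition slice (t : unit_itv R) : set T := closure [set g r t | r in setT].

(* L-Lipschitz paths from points of A to points of B whose endpoint relation is
   densely complete. *)
Definition connecting_family (L : R) (A B : set T) : Prop :=
  (forall r, exists a b, [/\ A a, B b & lipschitz_path L a b (g r)]) /\
  densely_complete A B endpoints.

End Family.
End Paths.

Section Statements.
Context {R : realType} {X Xt : metricType R} (iota : X -> Xt).
Variables (J : set (bcl X)) (A B : bcl X).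
Implicit Types (L : R) (gam : unit_itv R -> bcl X).

Definition tilde (C : set X) : set Xt := closure (iota @` C).

Definition trace (S : set Xt) : set X := iota @^-1` S.

Definition lipschitz_hyperpath L gam : Prop :=
  (forall t, J (gam t)) /\ lipschitz_path L A B gam.

(* The second clause asks that each slice be the closure of its trace on X, i.e.
   the completion of a member of J.  The first clause alone does not yield a path
   in J: for X the rationals, J = PCl(X), L = 1, A = {0, 5} and B = {1, 5}, the
   paths t |-> t and t |-> 5 in the real line have traces {t, 5} or {5} on X, but
   the value at t of a 1-Lipschitz path from A to B in BCl(X) would contain t for
   every t < 1, including the irrational ones.  The second clause
   holds automatically when X is complete. *)
Definition slices_in (G : Type) (g : G -> unit_itv R -> Xt) : Prop :=
  forall t, mem_sub J (trace (slice g t)) /\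
            slice g t `<=` tilde (trace (slice g t)).

Definition completion_family L (G : Type) (g : G -> unit_itv R -> Xt) : Prop :=
  connecting_family g L (tilde A) (tilde B) /\ slices_in g.

Definition has_completion_family L : Prop :=
  exists (G : Type) (g : G -> unit_itv R -> Xt), completion_family L g.

Definition completion_representation L gam : Prop :=
  exists (G : Type) (g : G -> unit_itv R -> Xt), completion_family L g /\
    forall t, bcl_set (gam t) = trace (slice g t).

Definition compact_family L (G : Type) (g : G -> unit_itv R -> X) : Prop :=
  connecting_family g L A B /\ forall t, mem_sub J (slice g t).

Definition has_compact_family L : Prop :=
  exists (G : Type) (g : G -> unit_itv R -> X), compact_family L g.

Definition represents L gam (G : Type) (g : G -> unit_itv R -> X) : Prop :=
  connecting_family g L A B /\ forall t, bcl_set (gam t) = slice g t.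

(* Collections of paths are compared as the ranges of indexed families. *)
Definition maximal_representation L gam : Prop :=
  exists (G : Type) (g : G -> unit_itv R -> X),
    [/\ compact_family L g, represents L gam g
      & forall (G' : Type) (g' : G' -> unit_itv R -> X), represents L gam g' ->
          range g `<=` range g' -> range g' = range g].

(* The equivalences and representations, with the constant L, for a given gam. *)
Definition applies_to L gam : Prop :=
  [/\ lipschitz_hyperpath L gam,
      (exists gam', lipschitz_hyperpath L gam') <-> has_completion_family L,
      completion_representation L gam
    & J `<=` @KCl R X ->
        ((exists gam', lipschitz_hyperpath L gam') <-> has_compact_family L) /\
        maximal_representation L gam].

End Statements.

(* Main.v *)
Require Import Defs.
From HB Require Import structures.
From mathcomp Require Import all_boot all_order all_algebra.
From mathcomp Require Import all_classical all_reals all_analysis.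
From mathcomp Require Import ring lra.

Import Order.TTheory GRing.Theory Num.Theory numFieldNormedType.Exports.

Local Open Scope classical_set_scope.
Local Open Scope ring_scope.

(** A family of paths yields a path of sets by taking the trace on X of the
    closed slices: moving along one member of the family from time s to time t
    shifts a point by at most L |s - t|, which bounds both excesses in the
    Hausdorff distance (family_hyperpath).

    The converse rests on lipschitz_selection.  Let gam be an L-Lipschitz path of
    sets whose completions K t are compact, and let x lie in K t0.  Nearest points
    in compact sets are attained, so every point of K s has a point of K t at
    distance at most L |s - t|.  Stepping through finitely many ordered times,
    forwards and backwards from t0, gives a point in each K t such that
    consecutive, hence all, pairs obey the Lipschitz bound at those times.  The
    product of the K t is compact, so these finite approximations have a cluster
    point, which is an L-Lipschitz path through x with values in the K t.  The
    family of all such selections therefore has slices exactly K t and an endpoint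
    relation that projects onto all of K 0 and of K 1.

    Both directions use only that X embeds isometrically into the space where the
    paths live and that the sets K t are compact there.  The completion of X
    satisfies this because a totally bounded set has compact closure in a complete
    space; when the members of J are compact, X itself, embedded by the identity,
    satisfies it.  In that case every representing path is a selection, so the
    family of all selections is maximal.  A quasigeodesic is by definition a
    Lipschitz path, and so is a path of constant speed because a chord is no
    longer than its arc. *)

Set Implicit Arguments.
Unset Strict Implicit.
Unset Printing Implicit Defensive.

(** * Metric preliminaries *)

Section Metric.
Context {R : realType} {T : metricType R}.

Lemma closure_mdistP (S : set T) x :
  closure S x <-> forall e : R, 0 < e -> exists2 y, S y & mdist x y < e.
Proof.
split=> [clS e e0|H U /nbhs_ballP[e /= e0 eU]].
  have [y [Sy]] := clS _ (nbhsx_ballx x e e0).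
  by rewrite ballEmdist; exists y.
have [y Sy xy] := H e e0; exists y; split=> //.
by apply: eU; rewrite ballEmdist.
Qed.

Lemma mdist_continuous (x : T) : continuous (mdist x : T -> R).
Proof.
move=> y; apply/(@cvgrPdist_lt _ R^o) => e e0; near=> z.
have yz : mdist y z < e.
  by near: z; apply/nbhs_ballP; exists e => //= z; rewrite ballEmdist.
apply: le_lt_trans yz; have := metric_triangle x y z.
have := metric_triangle x z y.
by rewrite (metric_sym z y) ler_norml; move=> *; apply/andP; split; lra.
Unshelve. all: by end_near. Qed.

Lemma compact_nearest_point (C : set T) (x : T) (r : R) : compact C ->
  (forall e, 0 < e -> exists2 y, C y & mdist x y < r + e) ->
  exists2 y, C y & mdist x y <= r.
Proof.
move=> cC near_r; have C0 : C !=set0.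
  by have [y Cy _] := near_r 1 ltr01; exists y.
have [|y /set_mem Cy ymin] := @compact_EVT_min T R (mdist x) C C0 cC.
  by apply: continuous_subspaceT; exact: mdist_continuous.
exists y => //; apply/ler_addgt0Pr => e /near_r[z Cz /ltW]; apply: le_trans.
exact/ymin/mem_set.
Qed.

Lemma lipschitz_continuous (L : R) (g : unit_itv R -> T) :
  lipschitz_map L g -> continuous g.
Proof.
move=> Lg s U /nbhs_ballP[e /= e0 gsU].
(* L may be negative or zero here, hence the modulus |L| + 1. *)
have L0 : 0 < `|L| + 1 by rewrite ltr_wpDl.
have cont_val : continuous (set_val : unit_itv R -> R).
  exact: initial_continuous.
have : nbhs s (set_val @^-1` ball (set_val s) (e / (`|L| + 1))).
  exact: cont_val (nbhsx_ballx _ _ (divr_gt0 e0 L0)).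
apply: filterS => t /= st; apply: gsU; rewrite ballEmdist /=.
apply: le_lt_trans (Lg s t) _.
apply: (@le_lt_trans _ _ ((`|L| + 1) * `|\val s - \val t|)).
  by rewrite ler_wpM2r// (le_trans (ler_norm L))// lerDl.
by rewrite mulrC -ltr_pdivlMr.
Qed.

(** An ultrafilter containing S contains, for each radius, one of the finitely
    many balls that cover S; so it is Cauchy and converges. *)
Lemma complete_totally_bounded_compact (S : set T) :
  complete_space T ->
  (forall e : R, 0 < e -> exists2 F : set T, finite_set F &
    S `<=` \bigcup_(x in F) ball x e) ->
  closed S -> compact S.
Proof.
move=> cT tbS clS; rewrite compact_ultra => U UU US.
have PU : ProperFilter U by exact: ultra_proper.
have Uball (e : R) : 0 < e -> exists x, U (ball x e).
  move=> /tbS[F finF SF]; apply: contrapT => noball.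
  have [y []] : (S `&` \bigcap_(x in F) ~` ball x e) !=set0.
    apply: (@filter_ex _ U); apply: filterI => //.
    have [X FX] := finite_fsetP.1 finF; rewrite {}FX in finF SF *.
    apply: filter_bigI => x _.
    by have [Ux|//] := in_ultra_setVsetC (ball x e) UU; case: noball; exists x.
  by move=> /SF[x Fx xy] /(_ x Fx).
have [l Ul] : exists l : T, U --> l.
  by apply: cT; apply: cauchy_exP.
exists l; split=> //; rewrite (closure_id S).1// => V /Ul UV.
exact: filter_ex (filterI US UV).
Qed.

End Metric.

(** * Lipschitz selections *)

Section Selection.
Context {R : realType} {T : metricType R} (L : R) (K : unit_itv R -> set T).
Hypothesis K_lipschitz : forall s t x, K s x ->
  exists2 y, K t y & mdist x y <= L * `|\val s - \val t|.

Let le_time (s t : unit_itv R) := \val s <= \val t.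

(** Induction on the list of times, removing the earliest time u: if u is the
    prescribed time t0, the rest of the chain starts from a point near x;
    otherwise the rest passes through x and is extended backwards to u.  The order
    of the times makes the bounds on consecutive steps add up. *)
Lemma chain_selection (l : seq (unit_itv R)) t0 x :
  sorted le_time l -> t0 \in l -> K t0 x ->
  exists c : unit_itv R -> T, [/\ forall t, K t (c t), c t0 = x &
    {in l &, forall s t, mdist (c s) (c t) <= L * `|\val s - \val t|}].
Proof.
have le_trans_time : transitive le_time by move=> s r t; exact: le_trans.
elim: l t0 x => [//|u l IH] t0 x sorted_ul t0l Kx.
have sorted_l : sorted le_time l := path_sorted sorted_ul.
have [ul|uNl] := boolP (u \in l).
  have mem_ul s : s \in u :: l -> s \in l by rewrite inE => /orP[/eqP->|].
  have [c [Kc ct0 cL]] := IH t0 x sorted_l (mem_ul _ t0l) Kx.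
  by exists c; split=> // s t /mem_ul sl /mem_ul tl; exact: cL.
case: l => [|v l] in IH sorted_ul t0l sorted_l uNl *.
  have [f Kf] : {f : unit_itv R -> T & forall t, K t (f t)}.
    by apply: choice => t; have [y] := K_lipschitz t Kx; exists y.
  exists (fun t => if t == t0 then x else f t); split=> [t||s t].
  - by case: eqP => [->|].
  - by rewrite eqxx.
  - move: t0l; rewrite !inE => /eqP-> /eqP-> /eqP->.
    by rewrite mdistxx subrr normr0 mulr0.
(* c is a selection along v :: l and y the value to be taken at u. *)
have [c [y [Kc Ky cy cL yt0]]] : exists c y, [/\ forall t, K t (c t), K u y,
    mdist y (c v) <= L * `|\val u - \val v|,
    {in v :: l &, forall s t, mdist (c s) (c t) <= L * `|\val s - \val t|} &
    (if t0 == u then y else c t0) = x].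
  have [t0u|t0Nu] := eqVneq t0 u.
    rewrite t0u in Kx.
    have [y Ky xy] := K_lipschitz v Kx.
    have [c [Kc cv cL]] := IH v y sorted_l (mem_head v l) Ky.
    by exists c, x; split=> //; rewrite cv.
  move: t0l; rewrite inE (negPf t0Nu) /= => t0l.
  have [c [Kc ct0 cL]] := IH t0 x sorted_l t0l Kx.
  have [y Ky cy] := K_lipschitz u (Kc v).
  by exists c, y; split=> //; rewrite metric_sym distrC.
have step s : s \in v :: l -> mdist y (c s) <= L * `|\val u - \val s|.
  move=> sl; apply: le_trans (metric_triangle y (c v) (c s)) _.
  have uv : \val u <= \val v by case/andP: sorted_ul.
  have vs : \val v <= \val s.
    move: sl; rewrite inE => /orP[/eqP->//|sl].
    by apply: (allP (order_path_min le_trans_time sorted_l)).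
  have -> : `|\val u - \val s| = `|\val u - \val v| + `|\val v - \val s|.
    by rewrite !ler0_norm ?subr_le0// ?(le_trans uv)//; ring.
  by rewrite mulrDr lerD// cL// mem_head.
exists (fun t => if t == u then y else c t); split=> // [t|s t].
  by case: eqP => [->|].
rewrite inE [t \in _]inE.
have [->|_] := eqVneq s u; have [->|_] := eqVneq t u => //=.
- by rewrite mdistxx subrr normr0 mulr0.
- by move=> _; exact: step.
- by move=> sl _; rewrite metric_sym distrC; exact: step.
- exact: cL.
Qed.

Hypothesis K_compact : forall t, compact (K t).

(** The selections through x that satisfy the Lipschitz bound at finitely many
    times generate a filter on the product of the sets K t, compact by Tychonoff;
    a cluster point satisfies the bound at all times. *)
Lemma lipschitz_selection t0 x : K t0 x ->
  exists c : unit_itv R -> T,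
    [/\ forall t, K t (c t), c t0 = x & lipschitz_map L c].
Proof.
move=> Kx.
pose P : set (unit_itv R -> T) := [set c | forall t, K t (c t)].
pose Q (l : seq (unit_itv R)) : set (unit_itv R -> T) :=
  [set c | [/\ P c, c t0 = x &
    {in l &, forall s t, mdist (c s) (c t) <= L * `|\val s - \val t|}]].
have Q0 l : Q l !=set0.
  have sorted_l : sorted le_time (sort le_time (t0 :: l)).
    by apply: sort_sorted => s t; exact: le_total.
  have t0l : t0 \in sort le_time (t0 :: l) by rewrite mem_sort mem_head.
  have [c [Kc ct0 cL]] := chain_selection sorted_l t0l Kx.
  exists c; split=> // s t sl tl.
  by apply: cL; rewrite mem_sort inE ?sl ?tl orbT.
have FQ : ProperFilter (filter_from setT Q).
  apply: filter_from_proper => //; apply: filter_from_filter.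
    by exists [::].
  move=> l m _ _; exists (l ++ m) => // c [Pc ct0 cL].
  by split; split=> // s t sl tl; apply: cL; rewrite mem_cat ?sl ?tl ?orbT.
have FP : filter_from setT Q P by exists [::] => // c [].
have [c [Pc clc]] := @tychonoff _ (fun=> T) _ K_compact _ FQ FP.
have approx s t (e : R) : 0 < e -> exists f, [/\ Q [:: s; t] f,
    mdist (c s) (f s) < e & mdist (c t) (f t) < e].
  move=> e0.
  have near_c r :
      nbhs (c : prod_topology (fun=> T)) [set f | mdist (c r) (f r) < e].
    have := @proj_continuous _ (fun=> T) r c _ (nbhsx_ballx (c r) e e0).
    by rewrite ballEmdist.
  have FQst : filter_from setT Q (Q [:: s; t]) by exists [:: s; t].
  have [f [Qf [fs ft]]] : (Q [:: s; t] `&` ([set f | mdist (c s) (f s) < e] `&`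
      [set f | mdist (c t) (f t) < e])) !=set0.
    apply: clc => //; apply: (@filterI _ (nbhs (c : prod_topology (fun=> T)))).
      exact: near_c.
    exact: near_c.
  by exists f.
exists c; split=> //.
  apply/eqP; rewrite -[_ == _]negbK -mdist_gt0; apply/negP => cx.
  by have [f [[_ -> _]]] := approx t0 t0 _ cx; rewrite ltxx.
move=> s t; apply/ler_addgt0Pr => e e0.
have e20 : 0 < e / 2 by rewrite divr_gt0.
have [f [[_ _ fL] fs ft]] := approx s t _ e20.
have {}fL := fL s t; rewrite !inE !eqxx orbT in fL.
apply: le_trans (metric_triangle _ (f s) _) _.
apply: le_trans (lerD (lexx _) (metric_triangle _ (f t) _)) _.
rewrite (metric_sym (f t)); move: (fL isT isT) fs ft; lra.
Qed.

End Selection.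

(** * Paths of sets and families of paths *)

Section Hyperpaths.
Context {R : realType} {X T : metricType R} (iota : X -> T).
Hypothesis iota_isometry : forall x y, mdist (iota x) (iota y) = mdist x y.
Variables (J : set (bcl X)) (A B : bcl X) (L : R).

Lemma trace_tilde (C : set X) : closed C -> trace iota (tilde iota C) = C.
Proof.
move=> clC; apply/seteqP; split=> x; last first.
  move=> Cx; apply/closure_mdistP => e e0.
  by exists (iota x); rewrite ?mdistxx//; exists x.
rewrite [in X in _ -> X](closure_id C).1// => /closure_mdistP Cx.
apply/closure_mdistP => e /Cx[_ [y Cy <-]].
by rewrite iota_isometry; exists y.
Qed.

Lemma excess_le_mdist (C D : bcl X) : excess C D <= mdist C D.
Proof. by rewrite le_max lexx. Qed.

(** The points of T and not only those of X are moved from one set to another at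
    the cost of the Hausdorff distance. *)
Lemma tilde_near (C D : bcl X) (x : T) (e : R) : 0 < e -> tilde iota C x ->
  exists2 y, tilde iota D y & mdist x y < mdist C D + e.
Proof.
move=> e0 /closure_mdistP Cx; have e20 : 0 < e / 2 by rewrite divr_gt0.
have [_ [c Cc <-] xc] := Cx _ e20.
have [d Dd cd] := (excess_leP C D _).1 (excess_le_mdist C D) c _ Cc e20.
exists (iota d); first by apply: (@subset_closure _ (iota @` D)); exists d.
move: (metric_triangle x (iota c) (iota d)); rewrite iota_isometry; lra.
Qed.

(** The second clause of slices_in is used to approximate the points reached by
    the paths, which lie in T, by points of the trace on X. *)
Lemma family_hyperpath (G : Type) (g : G -> unit_itv R -> T) :
  completion_family iota J A B L g ->
  exists gam, lipschitz_hyperpath J A B L gam.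
Proof.
move=> [[gL [QAB Adom Bimg]] gJ].
have [gam gamP] : {gam : unit_itv R -> bcl X & forall t,
    J (gam t) /\ bcl_set (gam t) = trace iota (slice g t)}.
  apply: (@choice _ _ (fun t C => J C /\ bcl_set C = trace iota (slice g t))) => t.
  by have [[C JC CE] _] := gJ t; exists C.
have ends (C : bcl X) t : slice g t = tilde iota C -> gam t = C.
  move=> gC; apply: bcl_eq.
  by rewrite (gamP t).2 gC trace_tilde//; exact: bcl_closed.
have gam0 : gam i0 = A.
  apply: ends; apply/seteqP; split.
    rewrite (closure_id (tilde iota A)).1; last exact: closed_closure.
    by apply: closureS => _ [r _ <-];
      have [a [b [Aa _ [[_ ga _] _]]]] := gL r; rewrite ga.
  apply: subset_trans Adom _; apply: closureS => a.
  move=> [_ [[a' b] [[/= a'a _] [r _ [ga _]]]]].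
  by exists r; rewrite // ga.
have gam1 : gam i1 = B.
  apply: ends; apply/seteqP; split.
    rewrite (closure_id (tilde iota B)).1; last exact: closed_closure.
    by apply: closureS => _ [r _ <-];
      have [a [b [_ Bb [[_ _ gb] _]]]] := gL r; rewrite gb.
  apply: subset_trans Bimg _; apply: closureS => b.
  move=> [_ [[a b'] [[_ /= b'b] [r _ [_ gb]]]]].
  by exists r; rewrite // gb.
have le_excess s t : excess (gam s) (gam t) <= L * `|\val s - \val t|.
  apply/excess_leP => x e; rewrite (gamP s).2 => gsx e0.
  have e30 : 0 < e / 3 by rewrite divr_gt0.
  have [_ [r _ <-] xr] := (closure_mdistP _ _).1 gsx _ e30.
  have /(gJ t).2/closure_mdistP/(_ _ e30)[_ [y gty <-] ry] : slice g t (g r t).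
    by apply: subset_closure; exists r.
  exists y; first by rewrite (gamP t).2.
  have [a [b [_ _ [_ gLr]]]] := gL r.
  have := metric_triangle (iota x) (g r s) (iota y).
  have := metric_triangle (g r s) (g r t) (iota y).
  move: (gLr s t) xr ry; rewrite iota_isometry; lra.
have gamL : lipschitz_map L gam.
  by move=> s t; rewrite ge_max le_excess distrC le_excess.
exists gam; split=> [t|]; first exact: (gamP t).1.
by split=> //; split=> //; exact: lipschitz_continuous gamL.
Qed.

Hypothesis J_compact : forall C : bcl X, J C -> compact (tilde iota C).

(** All L-Lipschitz paths in T that stay in the completions of the sets gam t, as
    an index type for the largest family representing gam. *)
Definition selection (gam : unit_itv R -> bcl X) : Type :=
  {c : unit_itv R -> T |
    (forall t, tilde iota (gam t) (c t)) /\ lipschitz_map L c}.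

Definition selection_path gam (c : selection gam) : unit_itv R -> T := sval c.

Lemma selection_through gam t x : lipschitz_hyperpath J A B L gam ->
  tilde iota (gam t) x -> exists c : selection gam, selection_path c t = x.
Proof.
move=> [Jgam [_ gamL]] gx.
have [||c [gc ct cL]] :=
  @lipschitz_selection _ _ L (tilde iota \o gam) _ _ t x gx.
- move=> s r y gy; apply: compact_nearest_point; first exact/J_compact/Jgam.
  move=> e e0; have [z gz yz] := tilde_near (gam r) e0 gy; exists z => //.
  by apply: lt_le_trans yz _; rewrite lerD2r; exact: gamL.
- by move=> s; exact/J_compact/Jgam.
by exists (exist _ c (conj gc cL)).
Qed.

Lemma slice_selection gam t : lipschitz_hyperpath J A B L gam ->
  slice (@selection_path gam) t = tilde iota (gam t).
Proof.
move=> gamP; apply/seteqP; split=> x.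
  rewrite [tilde _ _](closure_id _).1; last exact: closed_closure.
  by apply: closureS => _ [[c [gc cL]] _ <-]; exact: gc.
by move=> /(selection_through gamP)[c <-]; apply: subset_closure; exists c.
Qed.

Lemma trace_slice_selection gam t : lipschitz_hyperpath J A B L gam ->
  trace iota (slice (@selection_path gam) t) = gam t.
Proof.
by move=> gamP; rewrite slice_selection// trace_tilde//; exact: bcl_closed.
Qed.

Lemma selection_family gam : lipschitz_hyperpath J A B L gam ->
  completion_family iota J A B L (@selection_path gam).
Proof.
move=> gamP; have [Jgam [[_ gam0 gam1] gamL]] := gamP.
have in0 (c : selection gam) : tilde iota A (selection_path c i0).
  by rewrite -gam0; exact: (svalP c).1.
have in1 (c : selection gam) : tilde iota B (selection_path c i1).
  by rewrite -gam1; exact: (svalP c).1.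
split; last first.
  move=> t; rewrite trace_slice_selection// slice_selection//; split=> //.
  by exists (gam t).
split=> [c|].
  exists (selection_path c i0), (selection_path c i1); split=> //.
  have cL := (svalP c).2.
  by split=> //; split=> //; exact: lipschitz_continuous cL.
split; first by move=> _ [c _ <-]; split; [exact: in0|exact: in1].
  move=> a Aa; apply: subset_closure; split=> //.
  have /(selection_through gamP)[c ca] : tilde iota (gam i0) a by rewrite gam0.
  exists (a, selection_path c i1).
  by split; [split; last exact: in1 | exists c; rewrite ?ca].
move=> b Bb; apply: subset_closure; split=> //.
have /(selection_through gamP)[c cb] : tilde iota (gam i1) b by rewrite gam1.
exists (selection_path c i0, b).
by split; [split; first exact: in0 | exists c; rewrite ?cb].
Qed.

Lemma hyperpath_iff_family :
  (exists gam, lipschitz_hyperpath J A B L gam) <->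
  has_completion_family iota J A B L.
Proof.
split=> [[gam /selection_family gamF]|[G [g]]]; last exact: family_hyperpath.
by exists (selection gam), (@selection_path gam).
Qed.

Lemma hyperpath_representation gam : lipschitz_hyperpath J A B L gam ->
  completion_representation iota J A B L gam.
Proof.
move=> gamP; exists (selection gam), (@selection_path gam); split.
  exact: selection_family.
by move=> t; rewrite trace_slice_selection.
Qed.

End Hyperpaths.

(** * The completion of X, and X itself for compact members *)

Section CompletionTilde.
Context {R : realType} {X Xt : metricType R} (iota : X -> Xt).
Hypothesis Xt_completion : is_completion iota.

Lemma tilde_totally_bounded_compact (C : set X) :
  totally_bounded C -> compact (tilde iota C).
Proof.
have [iota_isometry _ cXt] := Xt_completion => tbC.
apply: complete_totally_bounded_compact => //; last exact: closed_closure.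
move=> e e0; have e20 : 0 < e / 2 by rewrite divr_gt0.
have [F [finF _ CF]] := tbC _ e20.
exists (iota @` F); first exact: finite_image.
move=> x /closure_mdistP/(_ _ e20)[_ [c Cc <-] xc].
have [z Fz] := CF _ Cc; rewrite ballEmdist /= => zc.
exists (iota z); first by exists z.
rewrite ballEmdist /=; move: (metric_triangle (iota z) (iota c) x).
rewrite iota_isometry (metric_sym (iota c)); lra.
Qed.

End CompletionTilde.

Section CompactMembers.
Context {R : realType} {X : metricType R}.
Variables (J : set (bcl X)) (A B : bcl X) (L : R).

Lemma tilde_id (C : set X) : closed C -> tilde id C = C.
Proof. by rewrite /tilde image_id => /closure_id. Qed.

(** Slices are closed in X, so with the identity as embedding the trace changes
    nothing and the second clause of slices_in is automatic. *)
Lemma compact_familyE (G : Type) (g : G -> unit_itv R -> X) :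
  compact_family J A B L g <-> completion_family id J A B L g.
Proof.
rewrite /compact_family /completion_family !tilde_id; try exact: bcl_closed.
split=> -[gAB gJ]; split=> // t; last exact: (gJ t).1.
by split; [exact: gJ | rewrite tilde_id//; exact: closed_closure].
Qed.

Hypothesis J_KCl : J `<=` @KCl R X.

Let J_compact (C : bcl X) : J C -> compact (tilde id C).
Proof. by move=> /J_KCl; rewrite tilde_id//; exact: bcl_closed. Qed.

Lemma hyperpath_iff_compact_family :
  (exists gam, lipschitz_hyperpath J A B L gam) <-> has_compact_family J A B L.
Proof.
rewrite (hyperpath_iff_family (iota := id))//.
by split=> -[G [g gP]]; exists G, g; apply/compact_familyE.
Qed.

(** A path in any family representing gam stays in the slices gam t, so it is
    already one of the selections. *)
Lemma hyperpath_maximal_representation gam : lipschitz_hyperpath J A B L gam ->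
  maximal_representation J A B L gam.
Proof.
move=> gamP; exists (selection id L gam), (@selection_path _ _ _ id L gam).
have idP : forall x y : X, mdist (id x) (id y) = mdist x y by [].
have F := (compact_familyE _).2 (selection_family idP J_compact gamP).
have sliceE t : bcl_set (gam t) = slice (@selection_path _ _ _ id L gam) t.
  exact: esym (trace_slice_selection idP J_compact t gamP).
split=> // [|G' g' [[g'L _] g'E] sub]; first by split=> //; exact: F.1.
apply/seteqP; split=> // _ [r _ <-].
have [a [b [_ _ [_ gL]]]] := g'L r.
have gr t : tilde id (gam t) (g' r t).
  rewrite tilde_id ?g'E; last exact: closed_closure.
  by apply: subset_closure; exists r.
by exists (exist _ (g' r) (conj gr gL)).
Qed.

End CompactMembers.

(** * Paths of constant speed *)

Section Speed.
Context {R : realType} {T : metricType R} (g : unit_itv R -> T).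

Lemma mdist_le_path_length (s t : unit_itv R) : \val s <= \val t ->
  ((mdist (g s) (g t))%:E <= path_length g s t)%E.
Proof.
rewrite le_eqVlt => /orP[/eqP/val_inj ->|st]; apply: ereal_sup_ubound.
  (* The partition of a degenerate interval is empty. *)
  exists [::]; first by split => /=.
  by rewrite /= big_ord0 mdistxx.
exists [:: t]; first exact: itv_partition1.
by rewrite big_ord_recl big_ord0 /= addr0.
Qed.

Lemma constant_speed_lipschitz : rectifiable g -> constant_speed g ->
  lipschitz_map (fine (path_length g i0 i1)) g.
Proof.
move=> rect speed.
have len : path_length g i0 i1 \is a fin_num.
  rewrite ge0_fin_numE//; apply: le_trans (mdist_le_path_length _).
    by rewrite lee_fin mdist_ge0.
  exact: ler01.
suff le_speed s t : \val s <= \val t -> mdist (g s) (g t) <=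
    fine (path_length g i0 i1) * `|\val s - \val t|.
  move=> s t; have [/le_speed//|/ltW/le_speed] := leP (\val s) (\val t).
  by rewrite metric_sym distrC.
move=> st; rewrite -lee_fin EFinM fineK// -speed//.
exact: mdist_le_path_length.
Qed.

End Speed.

Theorem mainTheorem1 (R : realType) (X Xt : metricType R) (iota : X -> Xt)
    (Xt_completion : is_completion iota) (L : R) (L_ge0 : 0 <= L)
    (J : set (bcl X)) (J_PCl : J `<=` @PCl R X)
    (J_covering : covering J) (J_stable : stable J)
    (A B : bcl X) (JA : J A) (JB : J B) :
  [/\ (exists gam, lipschitz_hyperpath J A B L gam) <->
        has_completion_family iota J A B L,
      forall gam : unit_itv R -> bcl X,
        lipschitz_hyperpath J A B L gam ->
        completion_representation iota J A B L gam,
      J `<=` @KCl R X ->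
        ((exists gam, lipschitz_hyperpath J A B L gam) <->
          has_compact_family J A B L) /\
        (forall gam : unit_itv R -> bcl X,
           lipschitz_hyperpath J A B L gam ->
           maximal_representation J A B L gam),
      forall lambda : R, 1 <= lambda ->
        [/\ (exists gam : unit_itv R -> bcl X,
               (forall t, J (gam t)) /\ quasigeodesic lambda A B gam) <->
              has_completion_family iota J A B (lambda * mdist A B),
            J `<=` @KCl R X ->
              ((exists gam : unit_itv R -> bcl X,
                 (forall t, J (gam t)) /\ quasigeodesic lambda A B gam) <->
                has_compact_family J A B (lambda * mdist A B))
          & forall gam : unit_itv R -> bcl X,
              (forall t, J (gam t)) -> quasigeodesic lambda A B gam ->
              applies_to iota J A B (lambda * mdist A B) gam]
    & forall gam : unit_itv R -> bcl X,
        (forall t, J (gam t)) -> is_path A B gam ->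
        rectifiable gam -> constant_speed gam ->
        applies_to iota J A B (fine (path_length gam i0 i1)) gam].
Proof.
have iota_isometry : forall x y, mdist (iota x) (iota y) = mdist x y.
  by case: Xt_completion.
have J_compact C : J C -> compact (tilde iota C).
  by move=> /J_PCl; exact: tilde_totally_bounded_compact.
have iff_family L' := hyperpath_iff_family iota_isometry A B L' J_compact.
have applies L' gam : lipschitz_hyperpath J A B L' gam ->
    applies_to iota J A B L' gam.
  move=> gamP; split=> // [|J_KCl]; first exact: hyperpath_representation.
  split; first exact: hyperpath_iff_compact_family.
  exact: hyperpath_maximal_representation.
have quasi_lipschitz lambda gam :
    (forall t, J (gam t)) /\ quasigeodesic lambda A B gam <->
    lipschitz_hyperpath J A B (lambda * mdist A B) gam.
  by split=> -[Jgam [[cont g0 g1] gL]]; split=> //; split=> //;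
    move: gL; rewrite g0 g1.
have quasi_ex lambda : (exists gam : unit_itv R -> bcl X,
      (forall t, J (gam t)) /\ quasigeodesic lambda A B gam) <->
    exists gam, lipschitz_hyperpath J A B (lambda * mdist A B) gam.
  by split=> -[gam /quasi_lipschitz]; exists gam.
split=> //.
- by move=> gam; exact: hyperpath_representation.
- move=> J_KCl; split; first exact: hyperpath_iff_compact_family.
  by move=> gam; exact: hyperpath_maximal_representation.
- move=> lambda _; rewrite !(propext (quasi_ex _)); split=> // [J_KCl|gam Jgam gq].
    exact: hyperpath_iff_compact_family.
  exact/applies/quasi_lipschitz.
- move=> gam Jgam path rect speed; apply: applies; split=> //; split=> //.
  exact: constant_speed_lipschitz.
Qed.
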